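(* Let $G$ and $H$ be graphs, with adjacency matrices $A_G$ and $A_H$. There exists a bi-resolving homomorphism from $G$ to $H$ if and only if there exists a subamalgamation matrix $S$, with rows indexed by $\mathcal{V}(G)$ and columns indexed by $\mathcal{V}(H)$, such that $$A_G S \leq S A_H \quad\text{and}\quad S^{\mathsf T} A_G \leq A_H S^{\mathsf T},$$ where the inequalities are entrywise.
   Context: A graph $G$ is a finite directed graph: a pair $(\mathcal{V}(G),\mathcal{E}(G))$ of a finite set of vertices and a finite set of edges, each edge having an initial and a terminal vertex (loops and multiple edges are allowed). The adjacency matrix $A_G$ is indexed by $\mathcal{V}(G)\times\mathcal{V}(G)$ and its $(I,J)$ entry is the number of edges from $I$ to $J$. A (graph) homomorphism $\Phi=(\Phi_{\mathcal V},\Phi_{\mathcal E}):G\to H$ is a pair of maps $\Phi_{\mathcal V}:\mathcal{V}(G)\to\mathcal{V}(H)$ and $\Phi_{\mathcal E}:\mathcal{E}(G)\to\mathcal{E}(H)$ respecting adjacency (an edge from $I$ to $J$ is sent to an edge from $\Phi_{\mathcal V}(I)$ to $\Phi_{\mathcal V}(J)$). $\Phi$ is right resolving if for each $I\in\mathcal{V}(G)$ the restriction of $\Phi_{\mathcal E}$ to the set of edges of $G$ starting from $I$, viewed as a map into the set of edges of $H$ starting from $\Phi_{\mathcal V}(I)$, is injective. It is left resolving if the same holds with ''starting from'' replaced by ''ending at''. It is bi-resolving if it is both left and right resolving. A subamalgamation matrix is a 0-1 matrix with exactly one $1$ in each row. $S^{\mathsf T}$ denotes the transpose of $S$. *)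

(* Defs.v *)
From HB Require Import structures.
From mathcomp Require Import all_boot all_order all_algebra.
Set Implicit Arguments.
Unset Strict Implicit.
Unset Printing Implicit Defensive.
Import GRing.Theory.
Local Open Scope ring_scope.

(* Finite directed graphs; loops and multiple edges are allowed. *)
Record digraph := Digraph {
  vertex : finType;
  edge : finType;
  init : edge -> vertex;
  term : edge -> vertex
}.

(* Rows and columns are indexed by the vertices through [enum_val], since
   MathComp matrices are indexed by ordinals. *)
Definition adjacency (G : digraph) : 'M[nat]_#|vertex G| :=
  \matrix_(i, j) #|[set e : edge G | (init e == enum_val i)
                                   && (term e == enum_val j)]|.

Record homomorphism (G H : digraph) := Homomorphism {
  vmap : vertex G -> vertex H;
  emap : edge G -> edge H;
  init_emap : forall e, init (emap e) = vmap (init e);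
  term_emap : forall e, term (emap e) = vmap (term e)
}.

(* By [init_emap], edges starting from I are mapped to edges starting from
   the image of I, so the codomain need not be restricted explicitly. *)
Definition right_resolving (G H : digraph) (Phi : homomorphism G H) : Prop :=
  forall I : vertex G, {in [set e | init e == I] &, injective (emap Phi)}.

Definition left_resolving (G H : digraph) (Phi : homomorphism G H) : Prop :=
  forall I : vertex G, {in [set e | term e == I] &, injective (emap Phi)}.

Definition bi_resolving (G H : digraph) (Phi : homomorphism G H) : Prop :=
  left_resolving Phi /\ right_resolving Phi.

(* Columns may be zero: the vertex map encoded by S need not be onto. *)
Definition subamalgamation (m n : nat) (S : 'M[nat]_(m, n)) : Prop :=
  (forall i j, S i j = 0 \/ S i j = 1) /\
  (forall i, exists! j, S i j = 1).

Definition lemx (m n : nat) (A B : 'M[nat]_(m, n)) : Prop :=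
  forall i j, (A i j <= B i j)%N.

(* Main.v *)
Require Import Defs.
From HB Require Import structures.
From mathcomp Require Import all_boot all_order all_algebra.
From mathcomp Require Import perm.
Set Implicit Arguments.
Unset Strict Implicit.
Unset Printing Implicit Defensive.
Import GRing.Theory.
Local Open Scope ring_scope.

(** A subamalgamation matrix is the matrix of a vertex map f, and the two
matrix inequalities then compare numbers of edges: for all vertices I of G and
K of H, there are at least as many edges from f I to K in H as there are edges
of G from I into the fibre of f over K, and likewise for the edges of G from
that fibre to I ([lemx_function_mx], used for G and H and for their reverses).
A bi-resolving homomorphism over f embeds each of these sets of edges of G into
the corresponding set of edges of H, which gives one direction.

For the converse, fix f.  Lifting f to a bi-resolving homomorphism means
choosing, for every edge e of G, an edge of H from f (init e) to f (term e) so
that edges with the same initial vertex, or the same terminal vertex, have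
different images.  Two edges whose images have different endpoints never
conflict.  So call edges e and e' adjacent on the left when they agree on
(init, f \o term), and on the right when they agree on (f \o init, term): this
makes the edges of G into the edges of a bipartite multigraph, the edges of H
into colours, and the inequalities bound the degree of a vertex by the number
of colours available around it.  König's edge-colouring theorem for bipartite
multigraphs ([konig_edge_coloring]) concludes. *)

(** * Edge colourings of bipartite multigraphs *)

Section Konig.

Variables (E C : finType) (X Y : eqType).
Variables (a : E -> X) (b : E -> Y) (D : E -> {set C}).

(** The bipartite multigraph with edge set E has endpoint maps a and b.  All
edges receive a colour, but only those of A are required not to conflict. *)
Definition proper_on (A : {set E}) (c : E -> C) : Prop :=
  [/\ forall g, c g \in D g,
      {in A &, forall g h, a g = a h -> c g = c h -> g = h}
    & {in A &, forall g h, b g = b h -> c g = c h -> g = h}].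

(** The edges of A at the endpoint p e do not include e, so they are strictly
fewer than the colours of the palette.  With p equal to a or to b this serves
both sides of the bipartition. *)
Lemma missing_color (T : eqType) (p : E -> T) (A : {set E}) (c : E -> C)
    (e : E) :
  e \notin A ->
  {in A &, forall g h, p g = p h -> c g = c h -> g = h} ->
  (#|[set g | p g == p e]| <= #|D e|)%N ->
  exists2 x, x \in D e & {in A, forall g, p g = p e -> c g <> x}.
Proof.
move=> eA inj_c le_De; set F := [set g in A | p g == p e].
have lt_F : (#|c @: F| < #|D e|)%N.
  rewrite card_in_imset; last first.
    move=> g h; rewrite !inE => /andP[gA /eqP pg] /andP[hA /eqP ph].
    by apply: inj_c => //; rewrite pg ph.
  apply: leq_trans le_De; apply: proper_card.
  apply/properP; split; first by apply/subsetP=> g; rewrite !inE => /andP[].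
  by exists e; rewrite !inE ?eqxx // (negPf eA).
have /subsetPn[x xD xF] : ~~ (D e \subset c @: F).
  by apply/negP=> /subset_leq_card; rewrite leqNgt lt_F.
exists x => // g gA pg cg; case/negP: xF; rewrite -cg.
by apply: imset_f; rewrite !inE gA pg eqxx.
Qed.

Section KempeChain.

Variables (A : {set E}) (c : E -> C) (alpha beta : C).

(** One step along a path of A coloured alternately alpha and beta.  The
direction matters: steps go through the a-endpoint of alpha edges and the
b-endpoint of beta edges, so that a path that enters its first edge through
the b-endpoint meets every a-endpoint by an alpha edge. *)
Definition kempe : rel E := fun g h =>
  [&& g \in A, h \in A &
    [&& c g == alpha, c h == beta & a g == a h]
    || [&& c g == beta, c h == alpha & b g == b h]].

Lemma kempe_connect_last e0 h :
  connect kempe e0 h -> h = e0 \/ exists2 k, connect kempe e0 k & kempe k h.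
Proof.
case/connectP=> p; case/lastP: p => [|p k] /= kp ->; first by left.
right; move: kp; rewrite rcons_path last_rcons => /andP[kp kk].
by exists (last e0 p) => //; apply/connectP; exists p.
Qed.

Lemma kempe_connect_mem e0 h : e0 \in A -> connect kempe e0 h -> h \in A.
Proof. by move=> e0A /kempe_connect_last[->|[k _ /and3P[]]]. Qed.

Lemma kempe_connect_color e0 h :
  c e0 = alpha -> connect kempe e0 h -> c h = alpha \/ c h = beta.
Proof.
move=> ce0 /kempe_connect_last[->|[k _ /and3P[_ _]]]; first by left.
by case/orP=> /and3P[_ /eqP-> _]; [right | left].
Qed.

Lemma kempe_connect_palette e0 h :
  (forall g g', a g = a g' -> D g = D g') ->
  (forall g g', b g = b g' -> D g = D g') ->
  connect kempe e0 h -> D h = D e0.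
Proof.
move=> Da Db /connectP[p + ->]; elim: p e0 => //= k p IHp e0 /andP[ek kp].
rewrite (IHp _ kp); case/and3P: ek => _ _.
by case/orP=> /and3P[_ _ /eqP/esym]; [apply: Da | apply: Db].
Qed.

Lemma kempe_pred_alpha e0 h :
  alpha != beta -> connect kempe e0 h -> c h = alpha ->
  h = e0 \/ exists k, [/\ connect kempe e0 k, k \in A, c k = beta & b k = b h].
Proof.
move=> ab /kempe_connect_last[->|[k ek /and3P[kA _ kh]]] ch; first by left.
move: kh; rewrite ch (negPf ab) andbF /= eqxx => /andP[/eqP ck /eqP bk].
by right; exists k.
Qed.

Lemma kempe_pred_beta e0 h :
  alpha != beta -> c e0 = alpha -> connect kempe e0 h -> c h = beta ->
  exists k, [/\ connect kempe e0 k, k \in A, c k = alpha & a k = a h].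
Proof.
move=> ab ce0 /kempe_connect_last[->|[k ek /and3P[kA _ kh]]] ch.
  by move: ab; rewrite -ce0 -ch eqxx.
move: kh; rewrite ch [beta == alpha]eq_sym (negPf ab) andbF orbF eqxx /=.
by case/andP=> /eqP ck /eqP ak; exists k.
Qed.

(** Swapping alpha and beta along the chain of e0 makes alpha missing, instead
of beta, at the b-endpoint y of e0.  If alpha is missing at an a-endpoint x, then
it remains so, because the chain never visits x: it could get there only by an
alpha edge. *)
Lemma kempe_swap (e0 : E) (y : Y) :
  (forall g g', a g = a g' -> D g = D g') ->
  (forall g g', b g = b g' -> D g = D g') ->
  proper_on A c -> alpha != beta -> alpha \in D e0 -> beta \in D e0 ->
  e0 \in A -> c e0 = alpha -> b e0 = y ->
  {in A, forall g, b g = y -> c g <> beta} ->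
  let c' g := if connect kempe e0 g then tperm alpha beta (c g) else c g in
  [/\ proper_on A c',
      {in A, forall g, b g = y -> c' g <> alpha}
    & forall x, {in A, forall g, a g = x -> c g <> alpha} ->
                {in A, forall g, a g = x -> c' g <> alpha}].
Proof.
move=> Da Db [cD ca cb] ab aD bD e0A ce0 be0 ymiss c'.
(* If g lies on the chain, h does not, and h has the swapped colour of g at a
   common endpoint, then h is the next or the previous edge of the chain at g,
   hence on the chain.  Only at the b-endpoint of e0 is there no previous edge,
   and there h would be the missing beta edge. *)
have mixa g h : g \in A -> h \in A -> connect kempe e0 g ->
    ~~ connect kempe e0 h -> a g = a h -> tperm alpha beta (c g) <> c h.
  move=> gA hA eg /negP eh agh; case: (kempe_connect_color ce0 eg) => cg.
    rewrite cg tpermL => /esym ch; apply: eh; apply: connect_trans eg _.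
    by apply: connect1; rewrite /kempe gA hA cg ch agh !eqxx.
  rewrite cg tpermR => /esym ch; apply: eh.
  have [k [ek kA ck ak]] := kempe_pred_beta ab ce0 eg cg.
  by rewrite -(ca k h kA hA) ?ck ?ch // ak.
have mixb g h : g \in A -> h \in A -> connect kempe e0 g ->
    ~~ connect kempe e0 h -> b g = b h -> tperm alpha beta (c g) <> c h.
  move=> gA hA eg /negP eh bgh; case: (kempe_connect_color ce0 eg) => cg.
    rewrite cg tpermL => /esym ch.
    case: (kempe_pred_alpha ab eg cg) => [ge0|[k [ek kA ck bk]]].
      by case: (ymiss h hA) => //; rewrite -bgh ge0.
    by apply: eh; rewrite -(cb k h kA hA) ?ck ?ch // bk.
  rewrite cg tpermR => /esym ch; apply: eh; apply: connect_trans eg _.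
  by apply: connect1; rewrite /kempe gA hA cg ch bgh !eqxx orbT.
split.
- split.
  + move=> g; rewrite /c'; case: ifP => // eg.
    rewrite (kempe_connect_palette Da Db eg).
    by case: (kempe_connect_color ce0 eg) => ->; rewrite ?tpermL ?tpermR.
  + move=> g h gA hA agh; rewrite /c'.
    case: ifPn => eg; case: ifPn => eh; last exact: ca.
    * by move/perm_inj; apply: ca.
    * by move/mixa=> H; case: H.
    * by move/esym/mixa=> H; case: H.
  + move=> g h gA hA bgh; rewrite /c'.
    case: ifPn => eg; case: ifPn => eh; last exact: cb.
    * by move/perm_inj; apply: cb.
    * by move/mixb=> H; case: H.
    * by move/esym/mixb=> H; case: H.
- move=> g gA bg; rewrite /c'; case: ifPn => eg.
    case: (kempe_connect_color ce0 eg) => cg; last by case: (ymiss g gA bg).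
    by rewrite cg tpermL => /esym/eqP; apply/negP.
  by move=> cg; case/negP: eg; rewrite (cb g e0) ?bg ?cg.
- move=> x xmiss g gA ag; rewrite /c'; case: ifPn => eg; last exact: xmiss.
  case: (kempe_connect_color ce0 eg) => cg; first by case: (xmiss g gA ag).
  have [k [_ kA ck ak]] := kempe_pred_beta ab ce0 eg cg.
  by case: (xmiss k kA); rewrite ?ak.
Qed.

End KempeChain.

Lemma proper_on_add (A : {set E}) (c : E -> C) (e : E) (x : C) :
  proper_on A c -> x \in D e ->
  {in A, forall g, a g = a e -> c g <> x} ->
  {in A, forall g, b g = b e -> c g <> x} ->
  proper_on (e |: A) (fun g => if g == e then x else c g).
Proof.
move=> [cD ca cb] xD amiss bmiss; split.
- by move=> g; case: eqP => [->|].
- move=> g h; rewrite !inE.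
  case: eqP => [-> _|_ /= gA]; case: eqP => [-> _|_ /= hA] //.
  + by move=> /esym agh /esym; case/(amiss h hA agh).
  + by move=> agh; case/(amiss g gA agh).
  + exact: ca.
- move=> g h; rewrite !inE.
  case: eqP => [-> _|_ /= gA]; case: eqP => [-> _|_ /= hA] //.
  + by move=> /esym bgh /esym; case/(bmiss h hA bgh).
  + by move=> bgh; case/(bmiss g gA bgh).
  + exact: cb.
Qed.

(** König's edge-colouring theorem, with a palette D attached to each connected
component.  Edges are added one at a time.  A new edge e sees a colour alpha
missing at its a-endpoint and a colour beta missing at its b-endpoint; swapping
alpha and beta along the chain that leaves the b-endpoint of e by its alpha edge
frees alpha there.  The graph being bipartite, this chain cannot reach the
a-endpoint of e, where alpha thus remains free. *)
Theorem konig_edge_coloring :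
  (forall g h, a g = a h -> D g = D h) ->
  (forall g h, b g = b h -> D g = D h) ->
  (forall e, #|[set g | a g == a e]| <= #|D e|)%N ->
  (forall e, #|[set g | b g == b e]| <= #|D e|)%N ->
  exists c : E -> C,
    [/\ forall e, c e \in D e,
        forall g h, a g = a h -> c g = c h -> g = h
      & forall g h, b g = b h -> c g = c h -> g = h].
Proof.
move=> Da Db leA leB.
suff [c [cD ca cb]] : exists c, proper_on setT c.
  by exists c; split=> // g h; [apply: ca | apply: cb]; rewrite inE.
have [n] := ubnP #|[set: E]|; elim: n setT => // n IHn A.
rewrite ltnS => leAn; have [->|[e eA]] := set_0Vmem A.
  have D_ex e : exists x, x \in D e.
    apply/set0Pn; rewrite -card_gt0; apply: leq_trans (leA e).
    by apply/card_gt0P; exists e; rewrite inE.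
  have [c cD] := fin_all_exists D_ex.
  by exists c; split=> // g h; rewrite inE.
rewrite -(setD1K eA); move: leAn; rewrite (cardsD1 e) eA add1n => leAn.
have eA' : e \notin A :\ e by rewrite !inE eqxx.
have [c cA] := IHn _ leAn; move: (A :\ e) eA' cA => {IHn leAn eA}A eA cA.
have [_ ca cb] := cA.
have [alpha aD amiss] := missing_color eA ca (leA e).
have [beta bD bmiss] := missing_color eA cb (leB e).
have [/existsP[e0 /and3P[e0A /eqP be0 /eqP ce0]] | /existsPn noalpha] :=
  boolP [exists g, [&& g \in A, b g == b e & c g == alpha]]; last first.
  eexists; apply: (proper_on_add cA aD amiss) => g gA bg cg.
  by have := noalpha g; rewrite gA bg cg !eqxx.
have ab : alpha != beta by apply/eqP=> ab; case: (bmiss e0); rewrite // -ab.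
have [aD0 bD0] : alpha \in D e0 /\ beta \in D e0 by rewrite (Db e0 e).
have [c'A b'miss /(_ _ amiss) a'miss] :=
  kempe_swap Da Db cA ab aD0 bD0 e0A ce0 be0 bmiss.
by eexists; apply: (proper_on_add c'A aD).
Qed.

End Konig.

(** * Subamalgamation matrices as vertex maps *)

Definition function_mx (V W : finType) (f : V -> W) : 'M[nat]_(#|V|, #|W|) :=
  \matrix_(i, j) (f (enum_val i) == enum_val j : nat).

Lemma subamalgamation_function_mx (V W : finType) (f : V -> W) :
  subamalgamation (function_mx f).
Proof.
split=> [i j|i]; first by rewrite mxE; case: eqP; [right | left].
exists (enum_rank (f (enum_val i))).
split; first by rewrite mxE enum_rankK eqxx.
by move=> j; rewrite mxE; case: eqP => // ->; rewrite enum_valK.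
Qed.

Lemma subamalgamationP (V W : finType) (S : 'M[nat]_(#|V|, #|W|)) :
  subamalgamation S -> exists f : V -> W, S = function_mx f.
Proof.
case=> S01 S1.
have {}S1 i : exists j, S i j = 1 /\ forall j', S i j' = 1 -> j = j'.
  by have [j Sj] := S1 i; exists j.
have [f fP] := fin_all_exists S1.
exists (fun v => enum_val (f (enum_rank v))).
apply/matrixP=> i j; rewrite mxE enum_valK (inj_eq enum_val_inj).
have [Sf fu] := fP i; case: eqP => [<- //|ne].
by case: (S01 i j) => // /fu.
Qed.

Lemma adjacency_mul_function_mx (G : digraph) (W : finType)
    (f : vertex G -> W) i j :
  (adjacency G *m function_mx f) i j =
  #|[set e : edge G | (init e == enum_val i) && (f (term e) == enum_val j)]|.
Proof.
rewrite mxE -sum1dep_card.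
rewrite (partition_big (fun e => enum_rank (term e)) predT) //=.
apply: eq_bigr => k _; rewrite !mxE.
transitivity (\sum_(e : edge G | (init e == enum_val i) &&
    (term e == enum_val k)) (f (enum_val k) == enum_val j : nat))%N.
  by rewrite sum_nat_cond_const cardsE.
rewrite big_mkcond [in RHS]big_mkcond /=; apply: eq_bigr => e _.
rewrite (can2_eq (@enum_rankK _) (@enum_valK _)) andbAC.
by case: eqP => //= _; case: eqP => [->|//]; case: eqP.
Qed.

Lemma function_mx_mul_adjacency (V : finType) (H : digraph)
    (f : V -> vertex H) i j :
  (function_mx f *m adjacency H) i j =
  #|[set e : edge H | (init e == f (enum_val i)) && (term e == enum_val j)]|.
Proof.
rewrite mxE (bigD1 (enum_rank (f (enum_val i)))) //= big1 => [|k kf].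
  by rewrite !mxE enum_rankK eqxx mul1r addr0.
rewrite !mxE [f _ == _](negPf _) ?mul0r //.
by apply: contraNneq kf => ->; rewrite enum_valK.
Qed.

Lemma lemx_function_mx (G H : digraph) (f : vertex G -> vertex H) :
  lemx (adjacency G *m function_mx f) (function_mx f *m adjacency H) <->
  forall I K, (#|[set e : edge G | (init e == I) && (f (term e) == K)]| <=
               #|[set e : edge H | (init e == f I) && (term e == K)]|)%N.
Proof.
split=> [le_mx I K|le_card i j].
  have := le_mx (enum_rank I) (enum_rank K).
  by rewrite adjacency_mul_function_mx function_mx_mul_adjacency !enum_rankK.
by rewrite adjacency_mul_function_mx function_mx_mul_adjacency.
Qed.

(** * Reversal *)

Definition reverse (G : digraph) : digraph := Digraph (@term G) (@init G).

Lemma adjacency_reverse (G : digraph) : adjacency (reverse G) = (adjacency G)^T.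
Proof.
by apply/matrixP=> i j; rewrite !mxE; apply: eq_card => e; rewrite !inE andbC.
Qed.

Lemma lemx_trmx (m n : nat) (A B : 'M[nat]_(m, n)) :
  lemx A^T B^T <-> lemx A B.
Proof. by split=> le_AB i j; have := le_AB j i; rewrite !mxE. Qed.

(** Reversing all edges exchanges left and right resolving, and this matches
the exchange of the two matrix inequalities; so only one of them has to be
interpreted. *)
Lemma lemx_reverse (G H : digraph)
    (S : 'M[nat]_(#|vertex G|, #|vertex H|)) :
  lemx (S^T *m adjacency G) (adjacency H *m S^T) <->
  lemx (adjacency (reverse G) *m S) (S *m adjacency (reverse H)).
Proof.
rewrite !adjacency_reverse; apply: iff_trans (iff_sym (lemx_trmx _ _)) _.
by rewrite !trmx_mul trmxK.
Qed.

Definition reverse_hom (G H : digraph) (Phi : homomorphism G H) :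
  homomorphism (reverse G) (reverse H) :=
  @Homomorphism (reverse G) (reverse H) (vmap Phi) (emap Phi)
    (term_emap Phi) (init_emap Phi).

(** * Bi-resolving homomorphisms *)

Lemma right_resolving_lemx (G H : digraph) (Phi : homomorphism G H) :
  right_resolving Phi ->
  lemx (adjacency G *m function_mx (vmap Phi))
       (function_mx (vmap Phi) *m adjacency H).
Proof.
move=> rr; apply/lemx_function_mx => I K.
rewrite -(@card_in_imset _ _ (emap Phi)) => [|g h].
  apply/subset_leq_card/subsetP=> _ /imsetP[e + ->].
  by rewrite !inE init_emap term_emap => /andP[/eqP-> ->]; rewrite eqxx.
by rewrite !inE => /andP[gI _] /andP[hI _]; apply: (rr I); rewrite inE.
Qed.

(** The coloured edges are those of G, the palette of an edge e being the set of
edges of H that e may be sent to. *)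
Lemma bi_resolving_lift (G H : digraph) (f : vertex G -> vertex H) :
  (forall I K, #|[set e : edge G | (init e == I) && (f (term e) == K)]| <=
               #|[set e : edge H | (init e == f I) && (term e == K)]|)%N ->
  (forall I K, #|[set e : edge G | (term e == I) && (f (init e) == K)]| <=
               #|[set e : edge H | (term e == f I) && (init e == K)]|)%N ->
  exists Phi : homomorphism G H, bi_resolving Phi.
Proof.
move=> le_out le_in.
pose a (e : edge G) := (init e, f (term e)).
pose b (e : edge G) := (term e, f (init e)).
pose D (e : edge G) :=
  [set e' : edge H | (init e' == f (init e)) && (term e' == f (term e))].
have [|||| c [cD ca cb]] := @konig_edge_coloring _ _ _ _ a b D.
- by move=> g h [ig tg]; rewrite /D ig tg.
- by move=> g h [tg ig]; rewrite /D ig tg.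
- by move=> e; have := le_out (init e) (f (term e)).
- move=> e; have := le_in (term e) (f (init e)).
  by congr (_ <= _)%N; apply: eq_card => e'; rewrite !inE andbC.
have init_c e : init (c e) = f (init e).
  by have := cD e; rewrite inE => /andP[/eqP].
have term_c e : term (c e) = f (term e).
  by have := cD e; rewrite inE => /andP[_ /eqP].
exists (Homomorphism init_c term_c).
split=> I g h; rewrite !inE /= => /eqP gI /eqP hI cgh.
  by apply: cb => //; rewrite /b gI hI -!init_c cgh.
by apply: ca => //; rewrite /a gI hI -!term_c cgh.
Qed.

Theorem theorem3p2 (G H : digraph) :
  (exists Phi : homomorphism G H, bi_resolving Phi) <->
  (exists S : 'M[nat]_(#|vertex G|, #|vertex H|),
     [/\ subamalgamation S,
         lemx (adjacency G *m S) (S *m adjacency H)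
       & lemx (S^T *m adjacency G) (adjacency H *m S^T)]).
Proof.
split=> [[Phi [lr rr]]|[S [/subamalgamationP[f ->] le_out le_in]]].
  exists (function_mx (vmap Phi)); split.
  - exact: subamalgamation_function_mx.
  - exact: right_resolving_lemx.
  - by apply/lemx_reverse; apply: (@right_resolving_lemx _ _ (reverse_hom Phi)).
apply: (@bi_resolving_lift G H f); first exact/lemx_function_mx.
move/lemx_reverse: le_in.
by move/(@lemx_function_mx (reverse G) (reverse H)).
Qed.
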